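(* Let $I$ be a nonzero proper ideal of $R$ such that $\omega\subseteq I:I$. Then $a(I)\ge r-1\ge 0$.
   Context: Setting: $(R,\mathfrak m)$ is a one-dimensional Noetherian local domain with infinite residue field $k$ and fraction field $K$. Its integral closure $\overline R$ in $K$ is a finite $R$-module and a discrete valuation ring with uniformizer $t$ (analytically irreducible), and $R$ is residually rational: the natural map $k\to\overline R/t\overline R$ is an isomorphism. $l_R$ denotes length of $R$-modules. For fractional ideals, $I:J=\{x\in K: xJ\subseteq I\}$ and $I^*=R:I$. $r=l_R((R:\mathfrak m)/R)$ is the Cohen–Macaulay type of $R$. $\omega$ is a canonical module of $R$ chosen as a fractional ideal with $R\subseteq\omega\subseteq\overline R$ (so $\omega:(\omega:J)=J$ for all nonzero fractional ideals $J$). For a nonzero proper ideal $I$ of $R$, $a(I)=l_R(I^*/R)-l_R(R/I)$. *)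

(* Defs.v *)
From HB Require Import structures.
From mathcomp Require Import all_boot all_order all_algebra.
From mathcomp Require Import boolp classical_sets cardinality.

Set Implicit Arguments.
Unset Strict Implicit.
Unset Printing Implicit Defensive.

Import GRing.Theory.
Local Open Scope ring_scope.

(* Membership predicates are classical: every subset, cut out by a Prop, is a
   {pred _} through asbool. An [idealr R] is a proper ideal. *)

Section Length.
Variables (R : pzRingType) (V : lmodType R).

Definition proper_sub (T : Type) (A B : {pred T}) : Prop :=
  {subset A <= B} /\ ~ {subset B <= A}.

(* Submodules of M / N are the submodules P with N <= P <= M; this is a chain
   of d proper inclusions between such submodules. *)
Definition submodule_chain (M N : {pred V}) (d : nat) : Prop :=
  exists C : nat -> {pred V},
    (forall i, (i <= d)%N ->
       [/\ submod_closed (C i), {subset N <= C i} & {subset C i <= M}]) /\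
    (forall i, (i < d)%N -> proper_sub (C i) (C i.+1)).

Definition has_length (M N : {pred V}) (d : nat) : Prop :=
  submodule_chain M N d /\ ~ submodule_chain M N d.+1.

(* The length of M / N, for submodules N <= M of V. The value is unique when it
   exists, because chains can be truncated; by convention it is 0 if chains are
   unbounded. *)
Definition length (M N : {pred V}) : nat :=
  xget 0%N [set d | has_length M N d]%classic.

Definition finitely_generated (M : {pred V}) : Prop :=
  exists s : seq V, forall x,
    x \in M <-> exists c : nat -> R, x = \sum_(i < size s) c i *: s`_i.

End Length.

Section Rings.
Variable R : comNzRingType.

(* The unit ideal is generated by 1, so it is enough to ask this, as well as
   principality below, of proper ideals. *)
Definition noetherian : Prop :=
  forall J : idealr R, @finitely_generated R R^o J.

Definition generates (a : R) (J : {pred R}) : Prop :=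
  forall x, x \in J <-> exists b, x = b * a.

Definition principal_ideal_ring : Prop :=
  forall J : idealr R, exists a, generates a J.

Definition maximal_ideal (m : idealr R) : Prop :=
  forall J : idealr R, {subset m <= J} -> {subset J <= m}.

Definition local_ring (m : idealr R) : Prop :=
  maximal_ideal m /\ forall n : idealr R, maximal_ideal n -> n =i m.

Definition prime_chain (d : nat) : Prop :=
  exists P : nat -> prime_idealr R,
    forall i, (i < d)%N -> proper_sub (P i) (P i.+1).

Definition krull_dim (d : nat) : Prop := prime_chain d /\ ~ prime_chain d.+1.

Definition discrete_valuation_ring (n : idealr R) : Prop :=
  [/\ GRing.integral_domain_axiom R, principal_ideal_ring, local_ring n
    & exists2 x, x \in n & x != 0].

End Rings.

Local Notation "x %:F" := (@FracField.tofrac _ x).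

Section FractionModule.
Variable R : idomainType.

Definition frac_scale (a : R) (x : {fraction R}) : {fraction R} := a%:F * x.

Fact frac_scaleA a b x : frac_scale a (frac_scale b x) = frac_scale (a * b) x.
Proof. by rewrite /frac_scale tofracM mulrA. Qed.
Fact frac_scale1 : left_id 1 frac_scale.
Proof. by move=> x; rewrite /frac_scale tofrac1 mul1r. Qed.
Fact frac_scaleDr : right_distributive frac_scale +%R.
Proof. by move=> a x y; rewrite /frac_scale mulrDr. Qed.
Fact frac_scaleDl x : {morph frac_scale^~ x : a b / a + b}.
Proof. by move=> a b; rewrite /frac_scale tofracD mulrDl. Qed.

HB.instance Definition _ := GRing.Zmodule_isLmodule.Build R {fraction R}
  frac_scaleA frac_scale1 frac_scaleDr frac_scaleDl.

End FractionModule.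

Section IntegralClosure.
Variable R : idomainType.

Definition integral_pred : {pred {fraction R}} :=
  fun x => `[< integralOver (@FracField.tofrac R) x >].

Fact integral_subring_closed : subring_closed integral_pred.
Proof.
split=> [|x y /asboolP ix /asboolP iy|x y /asboolP ix /asboolP iy].
- by apply/asboolP; apply: integral1.
- by apply/asboolP; apply: integral_sub.
- by apply/asboolP; apply: integral_mul.
Qed.

HB.instance Definition _ :=
  GRing.isSubringClosed.Build {fraction R} integral_pred
    integral_subring_closed.

Record integral_closure : Type := IntegralClosure {
  ic_val : {fraction R};
  ic_valP : ic_val \in integral_pred }.

HB.instance Definition _ := [isSub for ic_val].
HB.instance Definition _ := [Choice of integral_closure by <:].
HB.instance Definition _ :=
  [SubChoice_isSubComNzRing of integral_closure by <:].

Fact integral_tofrac (a : R) : a%:F \in integral_pred.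
Proof. by apply/asboolP; apply: integral_id. Qed.

Definition to_ic (a : R) : integral_closure :=
  IntegralClosure (integral_tofrac a).

End IntegralClosure.

Section FractionalIdeals.
Variable R : idomainType.
Implicit Types I J : {pred {fraction R}}.

Definition in_frac (I : {pred R}) : {pred {fraction R}} :=
  fun x => `[< exists2 a, a \in I & x = a%:F >].

Definition base_ring : {pred {fraction R}} := in_frac predT.

Definition colon I J : {pred {fraction R}} :=
  fun x => `[< forall y, y \in J -> x * y \in I >].

Definition nonzero_fractional_ideal J : Prop :=
  [/\ submod_closed J, exists2 x, x \in J & x != 0
    & exists2 d : R, d != 0 & forall x, x \in J -> d *: x \in base_ring].

(* Herzog and Kunz's definition of a canonical ideal of a one-dimensional
   Cohen-Macaulay ring: a fractional ideal for which J |-> w : J is a duality.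
   Such w are exactly the fractional ideals isomorphic to a canonical module. *)
Definition canonical_ideal (w : {pred {fraction R}}) : Prop :=
  nonzero_fractional_ideal w /\
  forall J, nonzero_fractional_ideal J -> colon w (colon w J) =i J.

Definition cm_type (m : {pred R}) : nat :=
  length (colon base_ring (in_frac m)) base_ring.

Definition a_invariant (I : {pred R}) : int :=
  (length (colon base_ring (in_frac I)) base_ring)%:Z
    - (length base_ring (in_frac I))%:Z.

(* The natural map R / m -> Rbar / n exists and is an isomorphism. *)
Definition residually_rational (m : idealr R)
    (n : idealr (integral_closure R)) : Prop :=
  exists phi : {rmorphism {ideal_quot m} -> {ideal_quot n}},
    (forall a : R,
       phi (\pi_({ideal_quot m})%qT a) = \pi_({ideal_quot n})%qT (to_ic a)) /\
    bijective phi.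

End FractionalIdeals.

Arguments integral_pred : clear implicits.
Arguments base_ring : clear implicits.

(* Main.v *)
Require Import Defs.
From HB Require Import structures.
From mathcomp Require Import all_boot all_order all_algebra.
From mathcomp Require Import boolp classical_sets cardinality.
From mathcomp Require Import ring zify.

Import GRing.Theory Num.Theory.
Local Open Scope ring_scope.

(** Write [l] for length, [Rbar] for the integral closure and [K] for the
    fraction field. The theorem holds because [a(I) = l(w / R)], and because the
    type [r] satisfies [1 <= r <= l(w / R) + 1].

    Since [w I] is contained in [I] and [R = w : w], an [x] in [w : I] satisfies
    [x w I <= x I <= w], hence [x I <= w : w = R]; so [R : I = w : I]
    ([colon_base_canonical]). The duality [J |-> w : J] reverses chains of
    fractional ideals ([dual_has_length]), hence
    [l((w : I) / w) = l((w : I) / (w : R)) = l(R / I)], and additivity of length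
    along [R <= w <= w : I] gives [l((R : I) / R) = l(R / I) + l(w / R)].

    For the upper bound on [r], [R : m] is contained in [w : m], and
    [l((w : m) / w) = l(R / m) = 1] by duality again, so that
    [r <= l((w : m) / R) = 1 + l(w / R)] ([type_le_colength]). For the lower
    bound, a nonzero [x] in [m] and an element [y] of [R] outside [x R] of
    largest valuation yield [y / x] in [R : m] but not in [R]
    ([colon_max_proper]).

    Both the finiteness of the lengths and the existence of such a [y] come from
    the filtration of [Rbar] by the [t ^ k Rbar]. Its steps are simple
    [R]-modules because [R] is residually rational ([val_ge_simple]), and every
    nonzero [R]-submodule of [Rbar] contains some [t ^ k Rbar]
    ([submod_val_ge]): [Rbar] is a finite [R]-module, so some nonzero [d] in [R]
    satisfies [d Rbar <= R], and a nonzero element of [Rbar] is a unit times a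
    power of [t]. *)

(** * Chains of submodules and additivity of length *)

Section Chains.
Context {R : pzRingType} {V : lmodType R}.
Implicit Types (M N P C : {pred V}) (d : nat).

Lemma chain_mono {M N M' N'} {d} :
  {subset M <= M'} -> {subset N' <= N} ->
  submodule_chain M N d -> submodule_chain M' N' d.
Proof.
move=> MM' NN' [C [Cb Cs]]; exists C; split=> // i /Cb[? NC CM].
by split=> // x => [/NN'/NC|/CM/MM'].
Qed.

Lemma chain_trunc {M N d e} :
  (e <= d)%N -> submodule_chain M N d -> submodule_chain M N e.
Proof.
move=> ed [C [Cb Cs]]; exists C; split=> i ie.
  by apply: Cb; apply: leq_trans ie ed.
by apply: Cs; apply: leq_trans ie ed.
Qed.

Lemma chain0 {M N} P : submod_closed P -> {subset N <= P} -> {subset P <= M} ->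
  submodule_chain M N 0.
Proof. by move=> *; exists (fun=> P). Qed.

Lemma chain_extend {M N M' d} :
  submodule_chain M N d -> submod_closed M' -> Defs.proper_sub M M' ->
  submodule_chain M' N d.+1.
Proof.
move=> [C [Cb Cs]] M'sub [MM' M'M].
exists (fun i => if (i <= d)%N then C i else M'); split=> i.
  move=> _; case: leqP => [/Cb[? ? CM]|_]; first by split=> // x /CM/MM'.
  by split=> // x; have [_ NC CM] := Cb 0%N isT; move=> /NC/CM/MM'.
rewrite ltnS => id; rewrite id.
case: (ltnP i d) => [/Cs//|di]; have -> : i = d by lia.
have [_ _ CM] := Cb d (leqnn d).
by split=> [x /CM/MM'//|M'C]; apply: M'M => x /M'C/CM.
Qed.

Lemma chain_cat {M P N a b} :
  submodule_chain M P a -> submodule_chain P N b -> submodule_chain M N (a + b).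
Proof.
move=> [C [Cb Cs]] PNb.
suff H i : (i <= a)%N -> submodule_chain (C i) N (i + b).
  by have [_ _ CM] := Cb a (leqnn a); apply: chain_mono (H a _).
elim: i => [_|i IH ia].
  by have [_ PC _] := Cb 0%N isT; apply: chain_mono PNb.
by apply: chain_extend (IH (ltnW ia)) _ (Cs _ ia); case: (Cb _ ia).
Qed.

Definition sum_sub (A B : {pred V}) : {pred V} :=
  fun x => `[< exists a b, [/\ a \in A, b \in B & x = a + b] >].

Lemma sum_subP A B x :
  reflect (exists a b, [/\ a \in A, b \in B & x = a + b]) (x \in sum_sub A B).
Proof. exact: asboolP. Qed.

Lemma sum_sub_closed A B :
  submod_closed A -> submod_closed B -> submod_closed (sum_sub A B).
Proof.
move=> [A0 Al] [B0 Bl]; split.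
  by apply/sum_subP; exists 0, 0; rewrite addr0.
move=> c _ _ /sum_subP[a [b [aA bB ->]]] /sum_subP[a' [b' [aA' bB' ->]]].
apply/sum_subP; exists (c *: a + a'), (c *: b + b').
by rewrite Al ?Bl // scalerDr addrACA.
Qed.

Definition cap_sub (A B : {pred V}) : {pred V} := [predI A & B].

Lemma cap_sub_closed A B :
  submod_closed A -> submod_closed B -> submod_closed (cap_sub A B).
Proof.
move=> [A0 Al] [B0 Bl]; split; first by rewrite inE A0 B0.
by move=> c u v /andP[? ?] /andP[? ?]; rewrite inE /= Al ?Bl.
Qed.

(** By the modular law a proper step of a chain in [M / N] stays proper either
    modulo [P] or after intersection with [P]; counting the steps of each kind
    is the subadditivity of length in the extension
    [0 -> P / N -> M / N -> M / P -> 0]. *)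
Lemma chain_split {M P N d} :
  submodule_chain M N d -> submod_closed P ->
  {subset N <= P} -> {subset P <= M} ->
  (forall x y, x \in M -> y \in M -> x + y \in M) ->
  exists a b,
    [/\ (d <= a + b)%N, submodule_chain M P a & submodule_chain P N b].
Proof.
move=> [C [Cb Cs]] Psub NP PM MD.
suff H i : (i <= d)%N -> exists a b, [/\ (i <= a + b)%N,
    submodule_chain (sum_sub (C i) P) P a
    & submodule_chain (cap_sub (C i) P) N b].
  have [a [b [dab ca cb]]] := H d (leqnn d); exists a, b; split=> //.
    apply: chain_mono ca => // x /sum_subP[y [z [yC zP ->]]].
    by have [_ _ CM] := Cb d (leqnn d); apply: MD; [apply: CM|apply: PM].
  by apply: chain_mono cb => // x /andP[].
have [P0 Pl] := Psub.
elim: i => [_|i IH id].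
  have [Csub NC CM] := Cb 0%N isT; exists 0%N, 0%N; split=> //.
    apply: (chain0 P) => // x xP; apply/sum_subP; exists 0, x.
    by rewrite add0r (proj1 Csub).
  apply: (chain0 (cap_sub (C 0%N) P)) => //; first exact: cap_sub_closed.
  by move=> x xN; rewrite inE NC ?NP.
have [a [b [iab ca cb]]] := IH (ltnW id).
have [Ci Ni Mi] := Cb _ (ltnW id); have [Cj Nj Mj] := Cb _ id.
have [sC nC] := Cs _ id.
have sS : {subset sum_sub (C i) P <= sum_sub (C i.+1) P}.
  move=> _ /sum_subP[y [z [yC zP ->]]]; apply/sum_subP.
  by exists y, z; split=> //; apply: sC.
have sI : {subset (cap_sub (C i) P) <= (cap_sub (C i.+1) P)}.
  by move=> x /andP[xC xP]; rewrite inE sC.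
have [pS|npS] :=
  pselect (Defs.proper_sub (sum_sub (C i) P) (sum_sub (C i.+1) P)).
  exists a.+1, b; split; first by lia.
    by apply: chain_extend ca _ pS; apply: sum_sub_closed.
  exact: chain_mono cb.
have [pI|npI] :=
  pselect (Defs.proper_sub (cap_sub (C i) P) (cap_sub (C i.+1) P)).
  exists a, b.+1; split; first by lia.
    exact: chain_mono ca.
  by apply: chain_extend cb _ pI; apply: cap_sub_closed.
have {npS} : {subset sum_sub (C i.+1) P <= sum_sub (C i) P}.
  by apply: contrapT => h; apply: npS.
have {npI} : {subset (cap_sub (C i.+1) P) <= (cap_sub (C i) P)}.
  by apply: contrapT => h; apply: npI.
(* Neither inclusion is proper, so the modular law gives C i.+1 <= C i. *)
move=> eI eS; case: nC => x xC.
have /eS/sum_subP[y [z [yC zP xE]]] : x \in sum_sub (C i.+1) P.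
  by apply/sum_subP; exists x, 0; rewrite addr0.
have /eI : z \in (cap_sub (C i.+1) P).
  rewrite inE zP andbT -[z](addKr y) -xE addrC -scaleN1r addrC.
  by apply: (proj2 Cj) => //; apply: sC.
move=> /andP[zC _]; rewrite xE -[y]scale1r.
exact: (proj2 Ci).
Qed.

Lemma chain2_simple {M N} :
  (forall C, submod_closed C -> {subset N <= C} -> {subset C <= M} ->
     {subset C <= N} \/ {subset M <= C}) ->
  ~ submodule_chain M N 2.
Proof.
move=> simp [C [Cb Cs]]; have [Csub NC CM] := Cb 1%N isT.
have [CN|MC] := simp _ Csub NC CM.
  have [_ NC0 _] := Cb 0%N isT; have [_] := Cs 0%N isT.
  by apply=> x /CN/NC0.
have [_ _ CM2] := Cb 2%N isT; have [_] := Cs 1%N isT.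
by apply=> x /CM2/MC.
Qed.

Lemma has_length_uniq {M N d e} : has_length M N d -> has_length M N e -> d = e.
Proof.
move=> [cd nd] [ce ne]; apply/eqP; rewrite eqn_leq.
apply/andP; split; rewrite leqNgt; apply/negP => lt.
  by apply: ne; apply: chain_trunc cd.
by apply: nd; apply: chain_trunc ce.
Qed.

Lemma lengthE {M N d} : has_length M N d -> length M N = d.
Proof.
by move=> h; apply: xget_unique => // e he; apply: has_length_uniq he h.
Qed.

(** [length] takes the junk value 0 when chains are unbounded, so every length
    that enters the argument first has to be shown to exist. *)
Lemma bounded_has_length {M N b} :
  submod_closed N -> {subset N <= M} -> ~ submodule_chain M N b.+1 ->
  exists2 d, has_length M N d & (d <= b)%N.
Proof.
move=> Nsub NM nb; have c0 : submodule_chain M N 0 by exact: (chain0 N).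
have ex : exists d, `[< submodule_chain M N d >] by exists 0%N; apply/asboolP.
have bd d : `[< submodule_chain M N d >] -> (d <= b)%N.
  move=> /asboolP c; rewrite leqNgt; apply/negP => lt.
  by apply: nb; apply: chain_trunc c.
case: (ex_maxnP ex bd) => d /asboolP cd dmax; exists d.
  by split=> // /asboolP/dmax; rewrite ltnn.
by apply/bd/asboolP.
Qed.

Lemma has_length_add {M P N a b} :
  submod_closed M -> submod_closed P -> {subset N <= P} -> {subset P <= M} ->
  has_length M P a -> has_length P N b -> has_length M N (a + b).
Proof.
move=> Msub Psub NP PM [ca na] [cb nb]; split; first exact: chain_cat ca cb.
move=> /chain_split/(_ Psub NP PM).
case=> [x y xM yM|a' [b' [ab ca' cb']]].
  by rewrite -[x]scale1r; apply: (proj2 Msub).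
have [lt|le] := ltnP a a'; first by apply: na; apply: chain_trunc ca'.
by apply: nb; apply: chain_trunc cb'; lia.
Qed.

End Chains.

(** * Maximal ideals and local principal ideal domains *)

Section Maximal.
Context {A : comNzRingType}.

Lemma idealr_of_closed {S : {pred A}} :
  idealr_closed S -> exists J : idealr A, J =i S.
Proof.
move=> Scl.
pose Sm := isIdealr.Build A S Scl.
pose J : idealr A := HB.pack S Sm.
by exists J.
Qed.

(** Zorn's lemma; the empty set is admitted among the candidates to bound the
    empty chain. *)
Lemma proper_ideal_sub_maximal (J : idealr A) :
  exists2 M : idealr A, maximal_ideal M & {subset J <= M}.
Proof.
pose P (X : set A) := X = set0 \/
  exists2 M : idealr A, {subset J <= M} & X = [set` M]%classic.
have [F FP tot|X [PX maxX]] := @Zorn_bigcup A P.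
  have [[X FX [x0 Xx0]]|noX] :=
    pselect (exists2 X, F X & exists x, X x); last first.
    left; apply/seteqP; split=> // x [X FX Xx]; apply: noX.
    by exists X => //; exists x.
  right.
  have idl X' x : F X' -> X' x ->
      exists2 M : idealr A, {subset J <= M} & X' = [set` M]%classic.
    by move=> /FP[->|//].
  pose S : {pred A} := fun x => `[< exists2 X, F X & X x >].
  have Scl : idealr_closed S.
    split.
    - apply/asboolP; exists X => //; have [M JM ->] := idl _ _ FX Xx0.
      by rewrite /= rpred0.
    - apply/negP => /asboolP[X' FX' X1]; have [M _ E] := idl _ _ FX' X1.
      by move: X1; rewrite E /= idealr1.
    move=> a u v /asboolP[U FU Uu] /asboolP[W FW Wv]; apply/asboolP.
    have [Y [FY Yu Yv]] : exists Y, [/\ F Y, Y u & Y v].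
      by case: (tot U W FU FW) => UW;
        [exists W|exists U]; split=> //; apply: UW.
    exists Y => //; have [M _ E] := idl _ _ FY Yu.
    by move: Yu Yv; rewrite E /= => Yu Yv; rewrite rpredD ?idealMr.
  have [M ME] := idealr_of_closed Scl.
  exists M => [x xJ|].
    rewrite ME; apply/asboolP; exists X => //.
    by have [M' JM' ->] := idl _ _ FX Xx0; apply: JM'.
  apply/seteqP; split=> x /=; rewrite ME; first by move=> h; apply/asboolP.
  by move=> /asboolP.
case: PX => [X0|[M JM XM]].
  case: (maxX [set` J]%classic); last by right; exists J.
  rewrite X0; split=> // /(_ 0); apply; exact: rpred0.
exists M => // M' MM'.
apply: contrapT => nM'; case: (maxX [set` M']%classic).
  by rewrite XM; split.
by right; exists M' => // x /JM/MM'.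
Qed.

End Maximal.

Section LocalPID.
Context {A : comNzRingType} {n : idealr A} {t : A}.
Hypothesis A_domain : GRing.integral_domain_axiom A.
Hypothesis A_principal : principal_ideal_ring A.
Hypothesis A_local : local_ring n.
Hypothesis t_generates : generates t n.
Hypothesis t_neq0 : t != 0.

(** An element that is not invertible generates a proper ideal, which lies in
    some maximal ideal, and [n] is the only one. *)
Lemma local_inverse u : u \notin n -> exists v, v * u = 1.
Proof.
move=> un; apply: contrapT => nov.
pose S : {pred A} := fun x => `[< exists b, x = b * u >].
have Scl : idealr_closed S.
  split; first by apply/asboolP; exists 0; rewrite mul0r.
    by apply/negP => /asboolP[b bu]; apply: nov; exists b.
  move=> a _ _ /asboolP[b ->] /asboolP[c ->]; apply/asboolP.
  by exists (a * b + c); rewrite mulrDl mulrA.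
have [J JS] := idealr_of_closed Scl.
have [M Mmax JM] := proper_ideal_sub_maximal J.
case/negP: un; rewrite -(proj2 A_local M Mmax); apply: JM; rewrite JS.
by apply/asboolP; exists 1; rewrite mul1r.
Qed.

Lemma domain_mulfI (x y z : A) : x != 0 -> x * y = x * z -> y = z.
Proof.
move=> x0 /eqP; rewrite -subr_eq0 -mulrBr => /eqP/A_domain.
by rewrite (negPf x0) /= subr_eq0 => /eqP.
Qed.

Lemma uniformizer_exp_neq0 k : t ^+ k != 0.
Proof.
elim: k => [|k IH]; first by rewrite expr0 oner_eq0.
apply/eqP; rewrite exprS => /A_domain.
by rewrite (negPf t_neq0) (negPf IH).
Qed.

(** If [x] had no such factorization, all [x / t ^ k] would be non-units; they
    generate an increasing sequence of principal ideals, whose union is a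
    principal ideal, hence generated by a single [x / t ^ k]. It contains
    [x / t ^ k.+1], which is then a multiple of [t] times itself, so that [t]
    would be invertible. *)
Lemma uniformizer_factor x :
  x != 0 -> exists k u v, x = t ^+ k * u /\ v * u = 1.
Proof.
move=> x0; apply: contrapT => nofac.
have nonunit k y : x = t ^+ k * y -> y \in n.
  move=> xy; apply: contrapT => /negP/local_inverse[v vy].
  by apply: nofac; exists k, y, v.
have next k y : x = t ^+ k * y -> exists2 z, x = t ^+ k.+1 * z & y = z * t.
  move=> xy; have /t_generates[z yz] := nonunit _ _ xy.
  by exists z => //; rewrite xy yz exprSr; ring.
have allk k : exists y, x = t ^+ k * y.
  elim: k => [|k [y /next[z xz _]]]; last by exists z.
  by exists x; rewrite expr0 mul1r.
have mono k l y z : (k <= l)%N -> x = t ^+ k * y -> x = t ^+ l * z ->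
    y = t ^+ (l - k) * z.
  move=> kl xy xz; apply: (@domain_mulfI (t ^+ k)).
    exact: uniformizer_exp_neq0.
  by rewrite -xy xz mulrA -exprD subnKC.
pose S : {pred A} := fun a => `[< exists k y b, x = t ^+ k * y /\ a = b * y >].
have Scl : idealr_closed S.
  split.
  - apply/asboolP; exists 0%N, x, 0; rewrite expr0 mul1r mul0r; split=> //.
  - apply/negP => /asboolP[k [y [b [xy by1]]]].
    by apply: nofac; exists k, y, b.
  move=> a _ _ /asboolP[k [y [b [xy ->]]]] /asboolP[l [z [c [xz ->]]]].
  apply/asboolP; case: (leqP k l) => kl.
    exists l, z, (a * b * t ^+ (l - k) + c); split=> //.
    by rewrite (mono _ _ _ _ kl xy xz); ring.
  exists k, y, (a * b + c * t ^+ (k - l)); split=> //.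
  by rewrite (mono _ _ _ _ (ltnW kl) xz xy); ring.
have [J JS] := idealr_of_closed Scl.
have [g Jg] := A_principal J.
have gJ : g \in J by apply/Jg; exists 1; rewrite mul1r.
move: gJ; rewrite JS => /asboolP[k [y [b [xy gy]]]].
have [z xz yz] := next _ _ xy.
have zJ : z \in J.
  by rewrite JS; apply/asboolP; exists k.+1, z, 1; rewrite mul1r.
have /Jg[c zc] := zJ.
have z0 : z != 0 by apply: contraNneq x0 => z0; rewrite xz z0 mulr0.
have : c * b * t = 1.
  by apply: (domain_mulfI z) => //; rewrite mulr1 {2}zc gy yz; ring.
move=> cbt1; have : 1 \in n by apply/t_generates; exists (c * b).
by rewrite idealr1.
Qed.

End LocalPID.

(** * Fractional ideals and canonical duality *)

Local Notation "x %:F" := (@FracField.tofrac _ x).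

Section Fractional.
Context {R : idomainType}.
Local Notation K := {fraction R}.
Implicit Types (A B M N C J w : {pred K}).

Lemma frac_scaleE (a : R) (x : K) : a *: x = a%:F * x.
Proof. by []. Qed.

Lemma frac_numden (x : K) : exists b a : R, b != 0 /\ b%:F * x = a%:F.
Proof.
rewrite -[x]reprK; set f := repr x; exists (frac f).2, (frac f).1.
split; first exact: denom_ratioP.
unlock FracField.tofrac; rewrite -[X in X = _]FracField.pi_mul.
apply/eqmodP; rewrite /= FracField.equivfE /FracField.mulf /=.
rewrite !numden_Ratio ?mulf_neq0 ?oner_neq0 ?denom_ratioP //.
by apply/eqP; ring.
Qed.

Lemma in_fracP (I : {pred R}) (x : K) :
  reflect (exists2 a, a \in I & x = a%:F) (x \in in_frac I).
Proof. exact: asboolP. Qed.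

Lemma base_ringP (x : K) : reflect (exists a, x = a%:F) (x \in base_ring R).
Proof.
by apply: (iffP (in_fracP predT x)) => [[a _ ->]|[a ->]]; exists a.
Qed.

Lemma colonP (A B : {pred K}) (x : K) :
  reflect (forall y, y \in B -> x * y \in A) (x \in colon A B).
Proof. exact: asboolP. Qed.

Lemma colon_closed A B : submod_closed A -> submod_closed (colon A B).
Proof.
move=> [A0 Al]; split; first by apply/colonP => y _; rewrite mul0r.
move=> a u v /colonP uA /colonP vA; apply/colonP => y yB.
by rewrite mulrDl frac_scaleE -mulrA Al ?uA ?vA.
Qed.

Lemma colon_antitone A B B' :
  {subset B <= B'} -> {subset colon A B' <= colon A B}.
Proof. by move=> BB' x /colonP xA; apply/colonP => y /BB'/xA. Qed.

Lemma colon_monotone A A' B :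
  {subset A <= A'} -> {subset colon A B <= colon A' B}.
Proof. by move=> AA' x /colonP xA; apply/colonP => y /xA/AA'. Qed.

Lemma sub_colon A J : submod_closed A -> {subset J <= base_ring R} ->
  {subset A <= colon A J}.
Proof.
move=> [A0 Al] JR x xA; apply/colonP => _ /JR/base_ringP[a ->].
by rewrite mulrC -frac_scaleE -[_ *: _]addr0 Al.
Qed.

Lemma in_frac_closed (I : idealr R) : submod_closed (in_frac I).
Proof.
split; first by apply/in_fracP; exists 0; rewrite ?rpred0 ?tofrac0.
move=> a _ _ /in_fracP[x xI ->] /in_fracP[y yI ->]; apply/in_fracP.
by exists (a * x + y); rewrite ?rpredD ?idealMr // tofracD tofracM.
Qed.

Lemma base_ring_closed : submod_closed (base_ring R).
Proof.
split; first by apply/base_ringP; exists 0; rewrite tofrac0.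
move=> a _ _ /base_ringP[x ->] /base_ringP[y ->]; apply/base_ringP.
by exists (a * x + y); rewrite tofracD tofracM.
Qed.

Lemma base_ring1 : 1 \in base_ring R.
Proof. by apply/base_ringP; exists 1; rewrite tofrac1. Qed.

Lemma in_frac_sub_base (I : {pred R}) : {subset in_frac I <= base_ring R}.
Proof. by move=> _ /in_fracP[x _ ->]; apply/base_ringP; exists x. Qed.

Lemma tofrac_in_frac (I : {pred R}) a : (a%:F \in in_frac I) = (a \in I).
Proof.
apply/in_fracP/idP => [[b bI /eqP]|aI]; last by exists a.
by rewrite tofrac_eq => /eqP->.
Qed.

Lemma base_ring_nfi : nonzero_fractional_ideal (base_ring R).
Proof.
split; first exact: base_ring_closed.
  by exists 1; rewrite ?base_ring1 ?oner_eq0.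
by exists 1; rewrite ?oner_eq0 // => x; rewrite scale1r.
Qed.

Lemma in_frac_nfi (I : idealr R) :
  (exists2 x, x \in I & x != 0) -> nonzero_fractional_ideal (in_frac I).
Proof.
move=> [x xI x0]; split; first exact: in_frac_closed.
  by exists x%:F; rewrite ?tofrac_in_frac ?tofrac_eq0.
exists 1; rewrite ?oner_eq0 // => y yI.
by rewrite scale1r; apply: in_frac_sub_base yI.
Qed.

Lemma nfi_between {M N} C : nonzero_fractional_ideal M ->
  nonzero_fractional_ideal N -> submod_closed C ->
  {subset N <= C} -> {subset C <= M} -> nonzero_fractional_ideal C.
Proof.
move=> [_ _ [d d0 dM]] [_ [x xN x0] _] Csub NC CM; split=> //.
  by exists x => //; apply: NC.
by exists d => // y /CM/dM.
Qed.

(** If [d] is a denominator for [w], and [y = a / b] is a nonzero element of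
    [J], then [d * a] is a denominator for [w : J]. *)
Lemma colon_nfi {w J} : nonzero_fractional_ideal w ->
  nonzero_fractional_ideal J -> nonzero_fractional_ideal (colon w J).
Proof.
move=> [wsub [x xw x0] [d d0 dw]] [Jsub [y yJ y0] [e e0 eJ]].
split; first exact: colon_closed.
  exists (e *: x); last by rewrite frac_scaleE mulf_neq0 ?tofrac_eq0.
  apply/colonP => z /eJ/base_ringP[a az].
  rewrite frac_scaleE mulrAC -frac_scaleE az -frac_scaleE -[a *: x]addr0.
  by apply: (proj2 wsub); rewrite ?(proj1 wsub).
have [b [a [b0 bya]]] := frac_numden y.
have a0 : a != 0 by rewrite -tofrac_eq0 -bya mulf_neq0 ?tofrac_eq0.
exists (d * a); first by rewrite mulf_neq0.
move=> z /colonP/(_ y yJ)/dw/base_ringP[c].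
rewrite frac_scaleE => zc; apply/base_ringP; exists (b * c).
by rewrite frac_scaleE !tofracM -zc -bya; ring.
Qed.

Section Duality.
Context {w : {pred K}}.
Hypothesis w_canonical : canonical_ideal w.

Lemma canonical_colonK J :
  nonzero_fractional_ideal J -> colon w (colon w J) = J.
Proof.
move=> Jnfi; apply/funext => x.
exact: (proj2 w_canonical J Jnfi x).
Qed.

(** The duality [J |-> w : J] is an inclusion-reversing injection, so it
    reverses chains without shortening them. *)
Lemma dual_chain {M N d} : nonzero_fractional_ideal M ->
  nonzero_fractional_ideal N -> submodule_chain M N d ->
  submodule_chain (colon w N) (colon w M) d.
Proof.
move=> Mnfi Nnfi [C [Cb Cs]]; exists (fun i => colon w (C (d - i)%N)).
have Cnfi i : (i <= d)%N -> nonzero_fractional_ideal (C i).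
  by move=> /Cb[Ci NC CM]; apply: nfi_between Mnfi Nnfi Ci NC CM.
split=> i id.
  have [Ci NC CM] := Cb _ (leq_subr i d).
  split; try exact: colon_antitone.
  by apply: colon_closed; case: w_canonical => [[]].
have [sub nsub] : Defs.proper_sub (C (d - i.+1)%N) (C (d - i)%N).
  by have -> : (d - i = (d - i.+1).+1)%N by [lia]; apply: Cs; lia.
split; first exact: colon_antitone.
move=> /colon_antitone - /(_ w); rewrite !canonical_colonK //; apply: Cnfi; lia.
Qed.

Lemma dual_chain_inv {M N d} : nonzero_fractional_ideal M ->
  nonzero_fractional_ideal N ->
  submodule_chain (colon w N) (colon w M) d -> submodule_chain M N d.
Proof.
move=> Mnfi Nnfi; have wnfi := proj1 w_canonical.
move=> /(dual_chain (colon_nfi wnfi Nnfi) (colon_nfi wnfi Mnfi)).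
by rewrite !canonical_colonK.
Qed.

Lemma dual_has_length {M N d} : nonzero_fractional_ideal M ->
  nonzero_fractional_ideal N ->
  has_length M N d -> has_length (colon w N) (colon w M) d.
Proof.
move=> Mnfi Nnfi [c nc]; split; first exact: dual_chain.
by move=> /(dual_chain_inv Mnfi Nnfi).
Qed.

Lemma canonical_colon_base : colon w (base_ring R) = w.
Proof.
have [[wsub _ _] _] := w_canonical.
suff H : colon w (base_ring R) =i w by apply/funext => x; exact: H.
move=> x; apply/idP/idP => [/colonP/(_ 1 base_ring1)|]; first by rewrite mulr1.
exact: sub_colon.
Qed.

Lemma canonical_colon_self : colon w w = base_ring R.
Proof.
by rewrite -{2}canonical_colon_base canonical_colonK //; apply: base_ring_nfi.
Qed.

(** [R = w : w], so [R : J] consists of the [x] with [x w J] contained in [w];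
    when [w J] is contained in [J] this is [w : J]. *)
Lemma colon_base_canonical J : {subset base_ring R <= w} ->
  {subset w <= colon J J} -> colon (base_ring R) J = colon w J.
Proof.
move=> Rw wJJ; suff H : colon (base_ring R) J =i colon w J.
  by apply/funext => x; exact: H.
move=> x; apply/idP/idP; first exact: colon_monotone.
move=> /colonP xw; apply/colonP => y yJ; rewrite -canonical_colon_self.
apply/colonP => v /wJJ/colonP/(_ y yJ) vyJ.
by rewrite -mulrA (mulrC y); apply: xw.
Qed.

End Duality.

End Fractional.

(** * The filtration of the integral closure by valuation *)

Section Filtration.
Context {R : idomainType} {m : idealr R}.
Context {n : idealr (integral_closure R)} {t : integral_closure R}.
Hypothesis Rbar_dvr : discrete_valuation_ring n.
Hypothesis t_uniformizer : generates t n.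
Hypothesis R_rational : residually_rational m n.
Local Notation K := {fraction R}.
Local Notation S := (integral_closure R).

(** For a uniformizer [s], the elements of [K] of valuation at least [k]. *)
Definition val_ge (s : S) (k : nat) : {pred K} :=
  fun z => `[< exists v : S, z = val (s ^+ k * v) >].

Lemma val_geP k z :
  reflect (exists v : S, z = val (t ^+ k * v)) (z \in val_ge t k).
Proof. exact: asboolP. Qed.

Lemma uniformizer_neq0 : t != 0.
Proof.
case: Rbar_dvr => _ _ _ [x /t_uniformizer[b ->]].
by apply: contraNneq => ->; rewrite mulr0.
Qed.

Lemma to_icM (a : R) (v : S) : val (to_ic a * v) = a%:F * val v.
Proof. by rewrite rmorphM. Qed.

Lemma val_ge_closed k : submod_closed (val_ge t k).
Proof.
split; first by apply/val_geP; exists 0; rewrite mulr0 rmorph0.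
move=> a _ _ /val_geP[u ->] /val_geP[v ->]; apply/val_geP.
exists (to_ic a * u + v).
by rewrite frac_scaleE -to_icM -rmorphD; congr val; ring.
Qed.

Lemma val_ge0 z : (z \in val_ge t 0) = (z \in integral_pred R).
Proof.
apply/val_geP/idP => [[v ->]|zi]; first exact: ic_valP.
by exists (IntegralClosure zi); rewrite expr0 mul1r.
Qed.

Lemma val_geS k : {subset val_ge t k.+1 <= val_ge t k}.
Proof.
by move=> _ /val_geP[v ->]; apply/val_geP; exists (t * v); rewrite exprSr mulrA.
Qed.

Lemma val_ge_le k l : (k <= l)%N -> {subset val_ge t l <= val_ge t k}.
Proof. by move=> /subnK<-; elim: (l - k)%N => // i IH x /val_geS/IH. Qed.

(** Since [k] is also the residue field of [Rbar], two elements of the same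
    valuation differ, up to a factor from [R], by one of larger valuation. *)
Lemma val_ge_simple k C : submod_closed C ->
  {subset val_ge t k.+1 <= C} -> {subset C <= val_ge t k} ->
  {subset C <= val_ge t k.+1} \/ {subset val_ge t k <= C}.
Proof.
move=> [_ Cl] FC CF.
have [[z zC zF]|no] :=
  pselect (exists2 z, z \in C & z \notin val_ge t k.+1); last first.
  by left=> z zC; apply: contrapT => /negP zF; apply: no; exists z.
right=> _ /val_geP[x ->].
have /val_geP[u zu] := CF _ zC.
have un : u \notin n.
  apply: contraNN zF => /t_uniformizer[b ub]; apply/val_geP; exists b.
  by rewrite zu ub exprSr -mulrA (mulrC b).
case: Rbar_dvr => _ _ nloc _.
have [v vu] := local_inverse nloc _ un.
have [phi [phiE [psi psiK phiK]]] := R_rational.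
(* The scalar repr q is congruent to x / u modulo n. *)
set q := psi (\pi_({ideal_quot n})%qT (x * v)).
have /eqP : \pi_({ideal_quot n})%qT (x * v) =
            \pi_({ideal_quot n})%qT (to_ic (repr q)).
  by rewrite -phiE reprK phiK.
rewrite -Quotient.idealrBE => /t_uniformizer[b xvb].
have -> : val (t ^+ k * x) = repr q *: z + val (t ^+ k.+1 * (b * u)).
  rewrite zu frac_scaleE -to_icM -rmorphD; congr val.
  have -> : x = (x * v - to_ic (repr q)) * u + to_ic (repr q) * u.
    by rewrite mulrBl subrK -mulrA vu mulr1.
  by rewrite xvb exprSr; ring.
by apply: Cl => //; apply: FC; apply/val_geP; exists (b * u).
Qed.

Lemma val_ge_length c : ~ submodule_chain (val_ge t 0) (val_ge t c) c.+1.
Proof.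
elim: c => [|c IH].
  move=> [C [Cb Cs]]; have [_ _ CM] := Cb 1%N isT; have [_ NC _] := Cb 0%N isT.
  by have [_] := Cs 0%N isT; apply=> x /CM/NC.
move=> /chain_split/(_ (val_ge_closed c) (@val_geS c) (@val_ge_le 0 c isT)).
case=> [x y xF yF|a [b [ab ca cb]]].
  by rewrite -[x]scale1r; apply: (proj2 (val_ge_closed 0)).
have [lt|le] := ltnP c a; first by apply: IH; apply: chain_trunc ca.
by apply: (chain2_simple (val_ge_simple c)); apply: chain_trunc cb; lia.
Qed.

Lemma val_ge_sub_multiples x : x \in integral_pred R -> x != 0 ->
  exists c, forall z, z \in val_ge t c ->
    exists2 y, y \in integral_pred R & z = x * y.
Proof.
move=> xi x0; case: Rbar_dvr => dom pid loc _.
have x'0 : IntegralClosure xi != 0 :> S.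
  apply: contraNneq x0 => x'0.
  by rewrite -[x]/(val (IntegralClosure xi)) x'0 rmorph0.
have [k [u [v [xku vu]]]] :=
  uniformizer_factor dom pid loc t_uniformizer uniformizer_neq0 _ x'0.
exists k => _ /val_geP[z ->]; exists (val (v * z)); first exact: ic_valP.
rewrite -[x]/(val (IntegralClosure xi)) xku -rmorphM; congr val.
by rewrite mulrA -(mulrA _ u) (mulrC u) vu mulr1.
Qed.

(** The map of residue fields [R / m -> Rbar / n] is well defined, so [m] maps
    into [n]. *)
Lemma max_ideal_val a k z :
  a \in m -> z \in val_ge t k -> a%:F * z \in val_ge t k.+1.
Proof.
move=> am /val_geP[v ->].
have [phi [phiE _]] := R_rational.
have : to_ic a \in n.
  rewrite -[to_ic a]subr0 Quotient.idealrBE -phiE.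
  have -> : \pi_({ideal_quot m})%qT a = \pi_({ideal_quot m})%qT 0.
    by apply/eqP; rewrite -Quotient.idealrBE subr0.
  by rewrite !rmorph0.
move=> /t_uniformizer[b ab]; apply/val_geP; exists (b * v).
by rewrite -to_icM ab exprSr; congr val; ring.
Qed.

Hypothesis Rbar_finite : finitely_generated (integral_pred R).

(** The product of denominators of a finite generating set conducts [Rbar] into
    [R]. *)
Lemma conductor_neq0 : exists2 d : R, d != 0 &
  forall x, x \in integral_pred R -> d *: x \in base_ring R.
Proof.
have [s sP] := Rbar_finite.
have [d d0 ds] :
    exists2 d : R, d != 0 & forall x, x \in s -> d *: x \in base_ring R.
  elim: (s) => [|x s' [d d0 ds]]; first by exists 1; rewrite ?oner_eq0.
  have [b [a [b0 bxa]]] := frac_numden x.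
  exists (d * b); first by rewrite mulf_neq0.
  move=> y; rewrite inE => /predU1P[->|/ds/base_ringP[c yc]]; apply/base_ringP.
    by exists (d * a); rewrite -scalerA !frac_scaleE bxa tofracM.
  by exists (b * c); rewrite mulrC -scalerA yc frac_scaleE tofracM.
exists d => // x /sP[c ->]; rewrite scaler_sumr.
have [R0 Rl] := base_ring_closed (R := R).
elim/big_ind: _ => // [y z yR zR|i _].
  by rewrite -[y]scale1r; apply: Rl.
rewrite scalerA mulrC -scalerA -[_ *: _]addr0; apply: Rl => //.
by apply: ds; apply: mem_nth.
Qed.

(** If [x] is a nonzero element of [N] and [d] conducts [Rbar] into [R], then
    [N] contains [x d Rbar]. *)
Lemma submod_val_ge N : submod_closed N -> {subset N <= integral_pred R} ->
  (exists2 x, x \in N & x != 0) -> exists c, {subset val_ge t c <= N}.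
Proof.
move=> [N0 Nl] Ni [x xN x0]; have [d d0 dR] := conductor_neq0.
have [||c cP] := @val_ge_sub_multiples (d *: x).
- by rewrite frac_scaleE rpredM ?integral_tofrac ?Ni.
- by rewrite frac_scaleE mulf_neq0 ?tofrac_eq0.
exists c => z /cP[y /dR/base_ringP[a ya] ->].
rewrite frac_scaleE mulrAC -frac_scaleE ya -frac_scaleE -[_ *: _]addr0.
exact: Nl.
Qed.

(** The module [M / N] is a subquotient of some [Rbar / t ^ c Rbar]; this
    applies to [R / I] and to [w / R]. *)
Lemma Rbar_finite_colength M N : {subset M <= integral_pred R} ->
  submod_closed N -> {subset N <= M} -> (exists2 x, x \in N & x != 0) ->
  exists d, has_length M N d.
Proof.
move=> Mi Nsub NM Nn0; have [x /NM/Mi|c cN] := submod_val_ge N Nsub _ Nn0 => //.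
have [|d hd _] := @bounded_has_length _ _ M N c Nsub NM; last by exists d.
move=> /(chain_mono _ cN) - /(_ (val_ge t 0)) ch.
by apply: (val_ge_length c); apply: ch => x /Mi; rewrite val_ge0.
Qed.

(** Choose [x != 0] in [m]. Among the elements of [R] outside [x R] there is
    one, [y], of largest valuation, because [x R] contains all elements of large
    valuation. Multiplication by [m] raises the valuation, hence [y m] is
    contained in [x R]: the class of [y / x] in [(R : m) / R] is not zero. *)
Lemma colon_max_proper : (exists2 x, x \in m & x != 0) ->
  exists2 z, z \in colon (base_ring R) (in_frac m) & z \notin base_ring R.
Proof.
move=> [x xm x0].
pose N : {pred K} := fun z => `[< exists a, z = (x * a)%:F >].
have NP z : reflect (exists a, z = (x * a)%:F) (z \in N) by exact: asboolP.
have Nsub : submod_closed N.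
  split; first by apply/NP; exists 0; rewrite mulr0 tofrac0.
  move=> a _ _ /NP[b ->] /NP[c ->]; apply/NP; exists (a * b + c).
  by rewrite frac_scaleE -tofracM -tofracD; congr (_%:F); ring.
have [z /NP[a ->]||c cN] := submod_val_ge N Nsub.
- exact: integral_tofrac.
- by exists x%:F; [apply/NP; exists 1; rewrite mulr1|rewrite tofrac_eq0].
pose P k := `[< exists2 y : R, y%:F \in val_ge t k & y%:F \notin N >].
have P0 : exists k, P k.
  exists 0%N; apply/asboolP; exists 1; first by rewrite val_ge0 integral_tofrac.
  apply/negP => /NP[a /eqP]; rewrite tofrac_eq => /eqP x1.
  by have := idealr1 m; rewrite x1 mulrC idealMr.
have Pc k : P k -> (k <= c)%N.
  move=> /asboolP[y yk /negP yN]; rewrite leqNgt; apply/negP => ck.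
  by apply: yN; apply: cN; apply: val_ge_le yk; apply: ltnW.
case: (ex_maxnP P0 Pc) => k /asboolP[y yk yN] kmax.
have xF0 : x%:F != 0 :> K by rewrite tofrac_eq0.
exists (y%:F / x%:F).
  apply/colonP => _ /in_fracP[a am ->]; apply: contrapT => nR.
  (* Otherwise a * y would be outside x R with a larger valuation than y. *)
  suff /kmax : P k.+1 by rewrite ltnn.
  apply/asboolP; exists (a * y); first by rewrite tofracM; apply: max_ideal_val.
  apply/negP => /NP[b ayb]; apply: nR; apply/base_ringP; exists b.
  by rewrite mulrAC -tofracM mulrC (mulrC y) ayb tofracM mulKf.
apply: contraNN yN => /base_ringP[a yxa]; apply/NP; exists a.
by rewrite tofracM -yxa mulrC divfK.
Qed.

End Filtration.

(** * The type and the invariant of an ideal *)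

(** If [m = 0] were maximal, both primes of a chain of length 1 would lie in
    [0]. *)
Lemma max_ideal_neq0 {R : idomainType} {m : idealr R} :
  maximal_ideal m -> prime_chain R 1 -> exists2 x, x \in m & x != 0.
Proof.
move=> mmax [P /(_ 0%N isT)[P01 P10]]; apply: contrapT => m0.
have m00 x : x \in m -> x = 0.
  by move=> xm; apply: contrapT => /eqP x0; apply: m0; exists x.
apply: P10 => x xP1.
have mP1 : {subset m <= P 1%N} by move=> y /m00->; rewrite rpred0.
by rewrite (m00 x) ?rpred0 //; apply: (mmax (P 1%N) mP1).
Qed.

Lemma max_ideal_simple {R : idomainType} {m : idealr R} : maximal_ideal m ->
  ~ submodule_chain (base_ring R) (in_frac m) 2.
Proof.
move=> mmax; apply: chain2_simple => C [C0 Cl] mC CR.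
have [C1|C1] := boolP (1 \in C).
  right=> _ /base_ringP[a ->].
  by rewrite -[_%:F]mulr1 -frac_scaleE -[_ *: _]addr0 Cl.
left=> z zC; have /base_ringP[a za] := CR z zC.
pose S : {pred R} := fun a => FracField.tofrac a \in C.
have SE c : (c \in S) = (c%:F \in C) by [].
have Scl : idealr_closed S.
  split; rewrite ?SE ?tofrac0 ?tofrac1 //.
  by move=> b u v; rewrite !SE tofracD tofracM => uC vC; apply: Cl.
have [J JS] := idealr_of_closed Scl.
rewrite za tofrac_in_frac; apply: (mmax J); last by rewrite JS SE -za.
by move=> b bm; rewrite JS SE; apply: mC; rewrite tofrac_in_frac.
Qed.

(** [(R : m) / R] sits inside [(w : m) / R], an extension of [(w : m) / w] by
    [w / R]. The dual of [(w : m) / w] is [R / m], which is simple. *)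
Lemma type_le_colength {R : idomainType} {m : idealr R}
    {w : {pred {fraction R}}} {b} :
  maximal_ideal m -> (exists2 x, x \in m & x != 0) -> canonical_ideal w ->
  {subset base_ring R <= w} -> has_length w (base_ring R) b ->
  exists2 r, has_length (colon (base_ring R) (in_frac m)) (base_ring R) r
    & (r <= b.+1)%N.
Proof.
move=> mmax m0 wcan Rw [_ nb].
have [[wsub _ _] _] := wcan.
have mR := in_frac_sub_base m.
have mnfi := in_frac_nfi m m0.
have wm := sub_colon _ _ wsub mR.
apply: bounded_has_length; first exact: base_ring_closed.
  exact: sub_colon base_ring_closed mR.
move=> /(chain_mono (colon_monotone _ _ _ Rw) (fun _ h => h)).
move=> /chain_split/(_ wsub Rw wm)[x y xC yC|i [j [bij ci cj]]].
  by rewrite -[x]scale1r; apply: (proj2 (colon_closed _ _ wsub)).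
have [lt|le] := ltnP b j; first by apply: nb; apply: chain_trunc cj.
apply: (max_ideal_simple mmax).
apply: (dual_chain_inv wcan (base_ring_nfi) mnfi).
by rewrite canonical_colon_base //; apply: chain_trunc ci; lia.
Qed.

Theorem corollary3p12
  (R : idomainType) (m : idealr R)
  (R_noetherian : noetherian R)
  (R_local : local_ring m)
  (R_dim1 : krull_dim R 1)
  (k_infinite : infinite_set [set: {ideal_quot m}]%classic)
  (Rbar_finite : finitely_generated (integral_pred R))
  (n : idealr (integral_closure R)) (t : integral_closure R)
  (Rbar_dvr : discrete_valuation_ring n)
  (t_uniformizer : generates t n)
  (R_rational : residually_rational m n)
  (w : {pred {fraction R}})
  (w_canonical : canonical_ideal w)
  (R_sub_w : {subset base_ring R <= w})
  (w_sub_Rbar : {subset w <= integral_pred R})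
  (I : idealr R)
  (I_nonzero : exists2 x, x \in I & x != 0)
  (w_sub_II : {subset w <= colon (in_frac I) (in_frac I)}) :
  (cm_type m)%:Z - 1 <= a_invariant I /\ 0 <= (cm_type m)%:Z - 1 :> int.
Proof.
have [mmax _] := R_local.
have m0 := max_ideal_neq0 mmax (proj1 R_dim1).
have Ri : {subset base_ring R <= integral_pred R}.
  by move=> x /R_sub_w/w_sub_Rbar.
have IR := in_frac_sub_base I.
have Infi := in_frac_nfi I I_nonzero.
have [Isub I0 _] := Infi.
have [Rsub R0 _] := base_ring_nfi (R := R).
have [wnfi _] := w_canonical; have [wsub _ _] := wnfi.
have finlen :=
  Rbar_finite_colength Rbar_dvr t_uniformizer R_rational Rbar_finite.
have [b wRb] := finlen _ _ w_sub_Rbar Rsub R_sub_w R0.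
have [a RIa] := finlen _ _ Ri Isub IR I0.
have wIwa := dual_has_length w_canonical base_ring_nfi Infi RIa.
rewrite canonical_colon_base // in wIwa.
have wwI := sub_colon _ _ wsub IR.
have [r hr rb] := type_le_colength mmax m0 w_canonical R_sub_w wRb.
(* R : I = w : I, and l((w : I) / R) = l(R / I) + l(w / R). *)
have aI : a_invariant I = b%:Z.
  rewrite /a_invariant (colon_base_canonical w_canonical) // (lengthE RIa).
  rewrite (lengthE (has_length_add _ _ R_sub_w wwI wIwa wRb)) //;
    last exact: colon_closed.
  lia.
have r1 : (0 < r)%N.
  have [z zm /negP zR] :=
    colon_max_proper Rbar_dvr t_uniformizer R_rational Rbar_finite m0.
  rewrite lt0n; apply/eqP => r0; case: hr => _; rewrite r0; apply.
  apply: (@chain_extend _ _ (base_ring R)).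
  - exact: (chain0 (base_ring R)).
  - exact: colon_closed.
  split; last by move=> /(_ z zm).
  exact: sub_colon Rsub (in_frac_sub_base m).
rewrite aI /cm_type (lengthE hr); lia.
Qed.
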